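(* Let $(W,g)$ be a compact Riemannian manifold. Then all the homotheties of the Riemannian cone $\mathcal C(W)$ are given by $(w,t)\mapsto(\psi(w),\rho\cdot t)$, where $\rho$ is the dilation factor and $\psi$ is an isometry of $W$. In particular, all the isometries of the cone $\mathcal C(W)$ come from those of $W$ (i.e. are of the form $\psi\times\mathrm{Id}_{\mathbb{R}^+}$ with $\psi$ an isometry of $W$).
   Context: The Riemannian cone of $(W,g)$ is $\mathcal C(W)=W\times\mathbb{R}^+$ with metric $\tilde g=dt^2+t^2g$. A homothety of $\mathcal C(W)$ with dilation factor $\rho>0$ is a diffeomorphism $f$ with $f^*\tilde g=\rho^2\,\tilde g$. *)

(* Defs.v *)
From HB Require Import structures.
From mathcomp Require Import all_boot all_order all_algebra.
From mathcomp Require Import all_classical all_reals all_analysis.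
Set Implicit Arguments.
Unset Strict Implicit.
Unset Printing Implicit Defensive.
Import Order.TTheory GRing.Theory Num.Theory.
Import numFieldNormedType.Exports.
Local Open Scope classical_set_scope.
Local Open Scope ring_scope.

(* C^k and C^oo on an open set U: a function is C^(k+1) when it is (Frechet)
   differentiable on U and all its directional derivatives are C^k. *)
Section smooth_on.
Variables (R : realType) (V W : normedModType R).

Fixpoint Ck_on (k : nat) (U : set V) (f : V -> W) : Prop :=
  if k is k'.+1 then (forall x, U x -> differentiable f x) /\
    forall v, Ck_on k' U (fun x => 'D_v f x)
  else forall x, U x -> {for x, continuous f}.

Definition smooth_on (U : set V) (f : V -> W) := forall k, Ck_on k U f.

End smooth_on.

Section smooth.
Variables (R : realType).
Implicit Types (V W : normedModType R).


Lemma near_eq_differentiable V W (f g : V -> W) x :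
  (\near x, f x = g x) -> differentiable f x -> differentiable g x.
Proof.
move=> fg df.
have h0 : (\near x, (g - f) x = 0).
  by near=> y; rewrite !fctE; apply/eqP; rewrite subr_eq0 eq_sym; apply/eqP; near: y.
have -> : g = f + (g - f) by rewrite addrC subrK.
apply: differentiableD => //.
move: (g - f) h0 => h h0.
have e1 : continuous (0 : V -> W) by move=> y; exact: cst_continuous.
have e2 : h \o shift x = cst (h x) + (\0 : {linear V -> W}) +o_ 0 id.
  have hx := nbhs_singleton h0.
  have hn : \forall y \near (0 : V), h (y + x) = 0.
    by move: h0; rewrite (near_shift 0) subr0.
  apply/eqaddoP => _/posnumP[e]; near=> y.
  rewrite !fctE /= hx (_ : h (y + x) = 0).
    by rewrite addr0 subr0 normr0.
  by near: y; exact: hn.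
have H := @diff_unique _ _ _ h (\0 : {linear V -> W}) x e1 e2.
by apply/diff_locallyP; rewrite H.
Unshelve. all: by end_near. Qed.

Lemma open_near V (U : set V) x : open U -> U x -> \forall y \near x, U y.
Proof. by move=> oU Ux; apply: open_nbhs_nbhs. Qed.

Lemma Ck_on_eq V W k (U : set V) (f g : V -> W) : open U ->
  (forall x, U x -> f x = g x) -> Ck_on k U f -> Ck_on k U g.
Proof.
move=> oU; elim: k f g => [|k IH] f g fg /=.
  move=> cf x Ux.
  have fgx : \forall y \near x, f y = g y by near do apply: fg; exact: open_near.
  have := cf x Ux; rewrite /prop_for /continuous_at (fg x Ux).
  apply: cvg_trans.
  by apply: near_eq_cvg.
move=> [df Df]; split=> [x Ux|v].
  apply: near_eq_differentiable (df x Ux).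
  by near do apply: fg; exact: open_near.
apply: IH (Df v) => x Ux; apply: near_eq_derive.
by near do apply: fg; exact: open_near.
Unshelve. all: by end_near. Qed.

Lemma Ck_on_sub V W k (U U' : set V) (f : V -> W) :
  U' `<=` U -> Ck_on k U f -> Ck_on k U' f.
Proof.
move=> UU; elim: k f => [|k IH] f /=; first by move=> cf x /UU; exact: cf.
by move=> [df Df]; split=> [x /UU|v]; [exact: df|exact: IH].
Qed.

Lemma Ck_on_le V W k (U : set V) (f : V -> W) :
  Ck_on k.+1 U f -> Ck_on k U f.
Proof.
elim: k f => [|k IH] f.
  by move=> [df _] x /df; exact: differentiable_continuous.
by move=> [df Df]; split => // v; apply: IH.
Qed.

Lemma Ck_on_cst V W k (U : set V) (c : W) : Ck_on k U (fun _ => c).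
Proof.
elim: k c => [|k IH] c; first by move=> x _; exact: cst_continuous.
split => [x _|v]; first exact: differentiable_cst.
by under eq_fun do rewrite derive_cst; exact: IH.
Qed.

Lemma Ck_on_linpre V W (V' : normedModType R) (L : {linear V' -> V}) k
    (U : set V) (f : V -> W) :
  open U -> continuous L -> Ck_on k U f -> Ck_on k (L @^-1` U) (f \o L).
Proof.
move=> oU cL; have oLU : open (L @^-1` U) by move/continuousP: cL; exact.
have dL x : differentiable L x by exact: linear_differentiable.
elim: k f => [|k IH] f.
  by move=> cf x /= Ux; apply: continuous_comp; [exact: cL|exact: cf].
move=> [df Df]; split=> [x /= Ux|v].
  by apply: differentiable_comp; [exact: dL|exact: df].
apply: Ck_on_eq (IH _ (Df (L v))) => // x /= Ux.
rewrite !deriveE; first last.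
- exact: df.
- by apply: differentiable_comp; [exact: dL|exact: df].
by rewrite (@diff_comp _ _ _ _ L f) ?diff_lin//=; exact: df.
Qed.

Lemma Ck_on_linpost V W (W' : normedModType R) (L : {linear W -> W'}) k
    (U : set V) (f : V -> W) :
  open U -> continuous L -> Ck_on k U f -> Ck_on k U (L \o f).
Proof.
move=> oU cL.
have dL x : differentiable L x by exact: linear_differentiable.
elim: k f => [|k IH] f.
  by move=> cf x /= Ux; apply: continuous_comp; [exact: cf|exact: cL].
move=> [df Df]; split=> [x /= Ux|v].
  by apply: differentiable_comp; [exact: df|exact: dL].
apply: Ck_on_eq (IH _ (Df v)) => // x /= Ux.
have dfx := df x Ux.
have dLf : differentiable (L \o f) x by exact: differentiable_comp.
rewrite !deriveE //.
rewrite (@diff_comp _ _ _ _ f L); [|exact: df|exact: dL].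
by rewrite /= (diff_lin _ cL).
Qed.

Lemma Ck_on_lin V W (L : {linear V -> W}) k (U : set V) :
  continuous L -> Ck_on k U L.
Proof.
move=> cL; case: k => [|k]; first by move=> x _; exact: cL.
split=> [x _|v]; first exact: linear_differentiable.
have -> : (fun x => 'D_v L x) = fun _ => L v; last exact: Ck_on_cst.
apply: funext => x; rewrite deriveE ?diff_lin//.
exact: linear_differentiable.
Qed.

Lemma Ck_onD V W k (U : set V) (f g : V -> W) :
  open U -> Ck_on k U f -> Ck_on k U g -> Ck_on k U (fun x => f x + g x).
Proof.
move=> oU; elim: k f g => [|k IH] f g.
  by move=> cf cg x Ux; apply: cvgD; [exact: cf|exact: cg].
move=> [df Df] [dg Dg]; split=> [x Ux|v].
  by apply: differentiableD; [exact: df|exact: dg].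
apply: Ck_on_eq (IH _ _ (Df v) (Dg v)) => // x Ux.
by rewrite -deriveD //; apply: diff_derivable; [exact: df|exact: dg].
Qed.

Lemma Ck_onM V k (U : set V) (f g : V -> R) :
  open U -> Ck_on k U f -> Ck_on k U g -> Ck_on k U (fun x => f x * g x).
Proof.
move=> oU; elim: k f g => [|k IH] f g.
  by move=> cf cg x Ux; apply: cvgM; [exact: cf|exact: cg].
move=> Cf Cg; have [[df Df] [dg Dg]] := (Cf, Cg); split=> [x Ux|v].
  by apply: differentiableM; [exact: df|exact: dg].
have := Ck_onD oU (IH _ _ (Ck_on_le Cf) (Dg v)) (IH _ _ (Ck_on_le Cg) (Df v)).
apply: Ck_on_eq => // x Ux.
by rewrite -[LHS]deriveM //; apply: diff_derivable; [exact: df|exact: dg].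
Qed.

Lemma Ck_on_sum V W k (U : set V) (I : finType) (f : I -> V -> W) :
  open U -> (forall i, Ck_on k U (f i)) -> Ck_on k U (fun x => \sum_i f i x).
Proof.
move=> oU Cf; elim: (index_enum I) => [|i s IH].
  by under eq_fun do rewrite big_nil; exact: Ck_on_cst.
by under eq_fun do rewrite big_cons; exact: Ck_onD.
Qed.

Lemma Ck_on_mx V k (U : set V) m n (f : V -> 'M[R]_(m, n)) :
  open U -> (forall i j, Ck_on k U (fun x => f x i j)) -> Ck_on k U f.
Proof.
move=> oU Cf.
have -> : f = fun x => \sum_(p : 'I_m * 'I_n) f x p.1 p.2 *: delta_mx p.1 p.2.
  apply: funext => x; rewrite {1}(matrix_sum_delta (f x)).
  by rewrite pair_bigA.
apply: Ck_on_sum => // -[i j] /=.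
have sx_lin : linear ( *:%R ^~ (delta_mx i j) : R -> 'M[R]_(m, n)).
  by move=> u y z; rewrite scalerDl scalerA.
pose sxlM := GRing.isLinear.Build _ _ _ _ _ sx_lin.
pose sxL : {linear R -> 'M[R]_(m, n)} := HB.pack ( *:%R ^~ (delta_mx i j)) sxlM.
have cL : continuous sxL by exact: scalel_continuous.
exact: (@Ck_on_linpost V R 'M[R]_(m, n) sxL k U (fun x => f x i j) oU cL).
Qed.

Lemma Ck_on_coord V k (U : set V) m n (f : V -> 'M[R]_(m, n)) i j :
  open U -> Ck_on k U f -> Ck_on k U (fun x => f x i j).
Proof.
move=> oU Cf.
have @c : {linear 'M[R]_(m, n) -> R}.
  by exists (fun N : 'M[R]_(_, _) => N i j); do 2![eexists]; do ?[constructor];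
     rewrite ?mxE// => ? *; rewrite ?mxE//; move=> ?; rewrite !mxE.
by apply: (@Ck_on_linpost V _ R c k U f oU) => //; exact: coord_continuous.
Qed.

End smooth.

(* Smooth n-manifold without boundary (Hausdorff, second countable, not
   necessarily connected) presented by a smooth atlas indexed by [chart_index].
   [chart i] and [param i] are total functions; they are mutually inverse
   homeomorphisms between the open sets [dom i] and [chart i @` dom i], and
   their values elsewhere are irrelevant. *)
Record manifold (R : realType) (n : nat) := Manifold {
  carrier :> topologicalType;
  chart_index : Type;
  dom : chart_index -> set carrier;
  chart : chart_index -> carrier -> 'rV[R]_n;
  param : chart_index -> 'rV[R]_n -> carrier;
  carrier_hausdorff : hausdorff_space carrier;
  carrier_second_countable : @second_countable carrier;
  dom_cover : forall p, exists i, dom i p;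
  dom_open : forall i, open (dom i);
  chart_open : forall i, open (chart i @` dom i);
  chartK : forall i p, dom i p -> param i (chart i p) = p;
  chart_continuous : forall i p, dom i p -> {for p, continuous (chart i)};
  param_continuous : forall i x,
    (chart i @` dom i) x -> {for x, continuous (param i)};
  transition_smooth : forall i j,
    smooth_on (chart i @` (dom i `&` dom j)) (chart j \o param i)
}.
Arguments dom {R n} m i.
Arguments chart {R n} m i.
Arguments param {R n} m i.

Section maps.
Variables (R : realType) (m n : nat) (M : manifold R m) (N : manifold R n).

Definition local_expr (f : M -> N) (i : chart_index M) (j : chart_index N) :
  'rV[R]_m -> 'rV[R]_n := chart N j \o f \o param M i.

Definition smooth_map (f : M -> N) := continuous f /\
  forall i j, smooth_on (chart M i @` (dom M i `&` f @^-1` dom N j))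
                        (local_expr f i j).

(* The differential of f at p, on vectors given by their coordinates in the
   charts i at p and j at f p. *)
Definition tangent_map (f : M -> N) i j (p : M) (u : 'rV[R]_m) : 'rV[R]_n :=
  'D_u (local_expr f i j) (chart M i p).

End maps.

Definition diffeomorphism (R : realType) (n : nat) (M N : manifold R n)
    (f : M -> N) :=
  smooth_map f /\ exists g : N -> M, [/\ cancel f g, cancel g f & smooth_map g].

(* A Riemannian metric: [gram i p] is the Gram matrix (g_ab) of the inner product
   of T_pM in the coordinate frame of the chart i. [gram_tensor] says that the
   inner product of two tangent vectors does not depend on the chart. Vectors are
   rows, hence u G v^T. *)
Record riemannianManifold (R : realType) (n : nat) := RiemannianManifold {
  underlying :> manifold R n;
  gram : chart_index underlying -> underlying -> 'M[R]_n;
  gram_sym : forall i p, dom underlying i p -> (gram i p)^T = gram i p;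
  gram_posdef : forall i p, dom underlying i p ->
    forall u : 'rV[R]_n, u != 0 -> 0 < (u *m gram i p *m u^T) 0 0;
  gram_smooth : forall i, smooth_on (chart underlying i @` dom underlying i)
    (gram i \o param underlying i);
  gram_tensor : forall i j p, dom underlying i p -> dom underlying j p ->
    forall u v : 'rV[R]_n,
    tangent_map idfun i j p u *m gram j p *m (tangent_map idfun i j p v)^T =
    u *m gram i p *m v^T
}.
Arguments gram {R n} r i p.

Definition inner (R : realType) (n : nat) (M : riemannianManifold R n)
    (i : chart_index M) (p : M) (u v : 'rV[R]_n) : R :=
  (u *m gram M i p *m v^T) 0 0.

(* The metric clause is f^*g = rho^2 g. *)
Definition homothety (R : realType) (n : nat) (M : riemannianManifold R n)
    (rho : R) (f : M -> M) :=
  [/\ 0 < rho, diffeomorphism f &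
    forall i j p, dom M i p -> dom M j (f p) -> forall u v : 'rV[R]_n,
      inner j (f p) (tangent_map f i j p u) (tangent_map f i j p v) =
      rho ^+ 2 * inner i p u v].

Arguments homothety {R n} M rho f.

Definition riemannian_isometry (R : realType) (n : nat) (M : riemannianManifold R n)
  (f : M -> M) := homothety M 1 f.
Arguments riemannian_isometry {R n} M f.

Section half_line.
Variable R : realType.

(* The half line, with the subspace topology. *)
Definition Rpos := set_type [set t : R | 0 < t].

Definition mkRpos (t : R) (t0 : 0 < t) : Rpos :=
  SigSub (mem_set (t0 : [set t : R | 0 < t] t)).

Lemma Rpos_gt0 (t : Rpos) : 0 < val t.
Proof. exact: set_valP t. Qed.

Definition Rpos_mul (s t : Rpos) : Rpos :=
  mkRpos (mulr_gt0 (Rpos_gt0 s) (Rpos_gt0 t)).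

Definition to_Rpos (t : R) : Rpos := insubd (mkRpos (@ltr01 R)) t.

Lemma to_RposK (t : R) : 0 < t -> val (to_Rpos t) = t.
Proof. by move=> t0; rewrite val_insubd mem_set. Qed.

Lemma valRposK : cancel (val : Rpos -> R) to_Rpos.
Proof. exact: valKd. Qed.

Lemma val_Rpos_continuous : continuous (val : Rpos -> R).
Proof. exact: (@initial_continuous Rpos R set_val). Qed.

Lemma to_Rpos_continuous (t : R) : 0 < t -> {for t, continuous to_Rpos}.
Proof.
move=> t0 U [_ [[B oB <-] /= Bt] BU].
have {}Bt : B t by move: Bt; rewrite set_valE to_RposK.
change (\forall s \near t, U (to_Rpos s)).
near=> s; apply: BU => /=; rewrite set_valE to_RposK; last first.
  by near: s; exact: lt_nbhsr.
by near: s; exact: open_nbhs_nbhs.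
Unshelve. all: by end_near. Qed.

Lemma Rpos_hausdorff : hausdorff_space Rpos.
Proof.
move=> s t st; apply: val_inj; apply: Rhausdorff => A B As Bt.
have [u [? ?]] := st _ _ (val_Rpos_continuous As) (val_Rpos_continuous Bt).
by exists (val u).
Qed.

Lemma Rpos_second_countable : @second_countable Rpos.
Proof.
exists [set (val : Rpos -> R) @^-1` `](ratr q.1), (ratr q.2)[%classic | q in [set: rat * rat]].
  by apply: card_le_trans (card_image_le _ _) _; exact: countableP.
split.
  move=> _ [q _ <-]; move/continuousP: val_Rpos_continuous; apply.
  exact: interval_open.
move=> t U [_ [[B oB <-] /= Bt] BU].
have : nbhs (val t) B by exact: open_nbhs_nbhs.
move=> /nbhs_ballP[e /= e0 eB].
have /rat_in_itvoo[a] : val t - e < val t by rewrite ltrBlDr ltrDl.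
rewrite in_itv /= => /andP[a1 a2].
have /rat_in_itvoo[b] : val t < val t + e by rewrite ltrDl.
rewrite in_itv /= => /andP[b1 b2].
exists ((val : Rpos -> R) @^-1` `](ratr a), (ratr b)[%classic).
  split; first by exists (a, b).
  by rewrite /= in_itv /= a2.
move=> s /=; rewrite in_itv /= => /andP[s1 s2]; apply: BU => /=; apply: eB.
rewrite /ball /= ltr_distlC (lt_trans a1)//=.
exact: lt_trans b2.
Qed.

End half_line.

Lemma prod_hausdorff (S T : topologicalType) :
  hausdorff_space S -> hausdorff_space T -> hausdorff_space (S * T)%type.
Proof.
move=> hS hT [s t] [s' t'] st; congr (_, _).
- apply: hS => A B As Bs.
  have [||p [[? _] [? _]]] := st (A `*` setT) (B `*` setT).
  + by exists (A, setT) => //=; split => //; exact: filterT.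
  + by exists (B, setT) => //=; split => //; exact: filterT.
  by exists p.1.
- apply: hT => A B As Bs.
  have [||p [[_ ?] [_ ?]]] := st (setT `*` A) (setT `*` B).
  + by exists (setT, A) => //=; split => //; exact: filterT.
  + by exists (setT, B) => //=; split => //; exact: filterT.
  by exists p.2.
Qed.

Lemma open_preimage (S T : topologicalType) (f : S -> T) (U : set T) :
  continuous f -> open U -> open (f @^-1` U).
Proof. by move/continuousP; exact. Qed.

Lemma open_setX (S T : topologicalType) (U : set S) (V : set T) :
  open U -> open V -> open (U `*` V).
Proof.
move=> oU oV; have -> : U `*` V = fst @^-1` U `&` snd @^-1` V by [].
apply: openI.
  by apply: open_preimage => // x; exact: cvg_fst.
by apply: open_preimage => // x; exact: cvg_snd.
Qed.

Lemma continuous_pair (X S T : topologicalType) (f : X -> S) (g : X -> T) x :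
  {for x, continuous f} -> {for x, continuous g} ->
  {for x, continuous (fun y => (f y, g y))}.
Proof. by move=> cf cg; exact: (cvg_pair cf cg). Qed.

Lemma prod_second_countable (S T : topologicalType) :
  @second_countable S -> @second_countable T ->
  @second_countable (S * T)%type.
Proof.
move=> [B cB [oB bB]] [C cC [oC bC]].
exists [set UV.1 `*` UV.2 | UV in B `*` C].
  by apply: card_le_trans (card_image_le _ _) _; exact: countableX.
split.
  by move=> _ [[U V] /= [BU CV] <-]; apply: open_setX; [exact: oB|exact: oC].
move=> [s t] O [[U V] /= [Us Vt] UVO].
have [U' [BU' U's] U'U] := bB s U Us.
have [V' [CV' V't] V'V] := bC t V Vt.
exists (U' `*` V'); first by split => //; exists (U', V').
move=> [x y] [/= U'x V'y]; apply: UVO; split; [exact: U'U|exact: V'V].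
Qed.

Lemma open_chart_image (R : realType) n (M : manifold R n) i (A : set M) :
  open A -> open (chart M i @` (dom M i `&` A)).
Proof.
move=> oA.
have -> : chart M i @` (dom M i `&` A) =
    chart M i @` dom M i `&` param M i @^-1` A.
  apply/seteqP; split=> [_ [p [ip Ap] <-]|_ [[p ip <-]]].
    by split; [exists p|rewrite /= chartK].
  by rewrite /= chartK // => Ap; exists p.
rewrite openE => x [ix Ax]; apply: filterI.
  by apply: open_nbhs_nbhs; split => //; exact: chart_open.
by apply: (param_continuous ix); exact: open_nbhs_nbhs.
Qed.

Section row_mx_smooth.
Variables (R : realType) (V : normedModType R) (n1 n2 : nat).

Lemma Ck_on_row_mx k (U : set V) (f : V -> 'rV[R]_n1) (g : V -> 'rV[R]_n2) :
  open U -> Ck_on k U f -> Ck_on k U g ->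
  Ck_on k U (fun x => row_mx (f x) (g x)).
Proof.
move=> oU Cf Cg; apply: Ck_on_mx => // i j.
under eq_fun do rewrite mxE.
by case: (fintype.split j) => j'; exact: Ck_on_coord.
Qed.

Lemma continuous_row_mx (T : topologicalType) (f : T -> 'rV[R]_n1)
    (g : T -> 'rV[R]_n2) (x : T) :
  {for x, continuous f} -> {for x, continuous g} ->
  {for x, continuous (fun y => row_mx (f y) (g y))}.
Proof.
move=> cf cg A /nbhs_ballP[e /= e0 eA].
have := cf _ (nbhsx_ballx (f x) _ e0); have := cg _ (nbhsx_ballx (g x) _ e0).
rewrite !nbhs_simpl => gx fx.
change (\forall y \near x, A (row_mx (f y) (g y))).
near=> y; apply: eA; split => // i j; rewrite !mxE.
have [_ fy] : ball (f x) e (f y) by near: y.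
have [_ gy] : ball (g x) e (g y) by near: y.
by case: (fintype.split j) => j'.
Unshelve. all: by end_near. Qed.

End row_mx_smooth.

Section cone.
Variables (R : realType) (n : nat).

(* The product manifold W x R^+: the coordinates of (w, t) are those of w followed
   by t. *)
Section cone_manifold.
Variable W : manifold R n.

Definition cone_dom (i : chart_index W) : set (W * Rpos R) := dom W i `*` setT.

Definition cone_chart (i : chart_index W) (p : W * Rpos R) : 'rV[R]_(n + 1) :=
  row_mx (chart W i p.1) (val p.2)%:M.

Definition cone_param (i : chart_index W) (x : 'rV[R]_(n + 1)) : W * Rpos R :=
  (param W i (lsubmx x), to_Rpos (rsubmx x 0 0)).

Lemma cone_chart_imageE i (A : set W) :
  cone_chart i @` ((dom W i `&` A) `*` setT) =
  [set x | (chart W i @` (dom W i `&` A)) (lsubmx x) /\ 0 < rsubmx x 0 0].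
Proof.
apply/seteqP; split => [_ [[p t] [/= ip _] <-]|x /= [[p ip px] x0]].
  rewrite /cone_chart /= row_mxKl row_mxKr mxE eqxx mulr1n; split.
    by exists p.
  exact: Rpos_gt0.
exists (p, to_Rpos (rsubmx x 0 0)) => //.
rewrite /cone_chart /= px to_RposK // -[RHS]hsubmxK; congr row_mx.
by rewrite [RHS]mx11_scalar.
Qed.

Lemma cone_chart_imageT i : cone_chart i @` cone_dom i =
  [set x | (chart W i @` dom W i) (lsubmx x) /\ 0 < rsubmx x 0 0].
Proof. by have := cone_chart_imageE i setT; rewrite setIT. Qed.

Lemma open_cone_image (U : set 'rV[R]_n) : open U ->
  open [set x : 'rV[R]_(n + 1) | U (lsubmx x) /\ 0 < rsubmx x 0 0].
Proof.
move=> oU; apply: openI.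
  by apply: open_preimage => //; exact: continuous_lsubmx.
apply: (@open_preimage _ _ (fun x : 'rV[R]_(n + 1) => rsubmx x 0 0)
  [set t : R | 0 < t]); last exact: open_gt.
move=> x; apply: (@continuous_comp _ _ _ rsubmx (fun y : 'rV[R]_1 => y 0 0)).
  exact: continuous_rsubmx.
exact: coord_continuous.
Qed.

Lemma cone_dom_cover p : exists i, cone_dom i p.
Proof. by have [i ip] := dom_cover p.1; exists i. Qed.

Lemma cone_dom_open i : open (cone_dom i).
Proof. by apply: open_setX; [exact: dom_open|exact: openT]. Qed.

Lemma cone_chart_open i : open (cone_chart i @` cone_dom i).
Proof. by rewrite cone_chart_imageT; apply: open_cone_image; exact: chart_open. Qed.

Lemma cone_chartK i p : cone_dom i p -> cone_param i (cone_chart i p) = p.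
Proof.
case: p => w t [/= iw _]; rewrite /cone_param /cone_chart /= row_mxKl row_mxKr.
by rewrite chartK // mxE eqxx mulr1n valRposK.
Qed.

Lemma cone_chart_continuous i p :
  cone_dom i p -> {for p, continuous (cone_chart i)}.
Proof.
move=> [ip _]; apply: continuous_row_mx.
  by apply: continuous_comp; [exact: cvg_fst|exact: chart_continuous].
apply: (@continuous_comp _ _ _ snd (fun t : Rpos R => (val t)%:M : 'rV[R]_1)).
  exact: cvg_snd.
apply: (@continuous_comp _ _ _ (val : Rpos R -> R)
  (fun t : R => t%:M : 'rV[R]_1)).
  exact: val_Rpos_continuous.
move=> A /nbhs_ballP[e /= e0 eA]; apply/nbhs_ballP; exists e => //= y xy.
by apply: eA; split => // k l; rewrite !ord1 !mxE !eqxx !mulr1n.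
Qed.

Lemma cone_param_continuous i x : (cone_chart i @` cone_dom i) x ->
  {for x, continuous (cone_param i)}.
Proof.
rewrite cone_chart_imageT => -[ix x0]; apply: continuous_pair.
  apply: (@continuous_comp _ _ _ lsubmx); first exact: continuous_lsubmx.
  exact: param_continuous.
apply: (@continuous_comp _ _ _ rsubmx (fun y => to_Rpos (y 0 0))).
  exact: continuous_rsubmx.
apply: (@continuous_comp _ _ _ (fun y : 'rV[R]_1 => y 0 0) (@to_Rpos R)).
  exact: coord_continuous.
exact: to_Rpos_continuous.
Qed.

Lemma cone_transitionE i j x : 0 < rsubmx x 0 0 ->
  cone_chart j (cone_param i x) =
  row_mx (chart W j (param W i (lsubmx x))) (rsubmx x).
Proof.
by move=> x0; rewrite /cone_chart /= to_RposK // -mx11_scalar.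
Qed.

Lemma cone_transition_smooth i j :
  smooth_on (cone_chart i @` (cone_dom i `&` cone_dom j))
            (cone_chart j \o cone_param i).
Proof.
move=> k; have -> : cone_dom i `&` cone_dom j =
    (dom W i `&` dom W j) `*` setT.
  apply/seteqP; split=> [[w t] [[iw _] [jw _]]|[w t] [[iw jw] _]] //.
rewrite cone_chart_imageE.
have oU := @open_chart_image _ _ W i _ (dom_open j).
apply: (@Ck_on_eq _ _ _ k _ (fun x => row_mx
   ((chart W j \o param W i) (lsubmx x)) (rsubmx x))).
- exact: open_cone_image.
- by move=> x [_ x0]; rewrite /= cone_transitionE.
apply: Ck_on_row_mx; first exact: open_cone_image.
  apply: Ck_on_sub (Ck_on_linpre oU (@continuous_lsubmx _ _ _ _)
    (transition_smooth i j k)) => x [] //.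
exact: Ck_on_lin (@continuous_rsubmx _ _ _ _).
Qed.

Definition cone_manifold : manifold R (n + 1) := {|
  carrier := (W * Rpos R)%type;
  chart_index := chart_index W;
  dom := cone_dom;
  chart := cone_chart;
  param := cone_param;
  carrier_hausdorff :=
    prod_hausdorff (@carrier_hausdorff _ _ W) (@Rpos_hausdorff R);
  carrier_second_countable := prod_second_countable
    (@carrier_second_countable _ _ W) (@Rpos_second_countable R);
  dom_cover := cone_dom_cover;
  dom_open := cone_dom_open;
  chart_open := cone_chart_open;
  chartK := cone_chartK;
  chart_continuous := cone_chart_continuous;
  param_continuous := cone_param_continuous;
  transition_smooth := cone_transition_smooth
|}.

End cone_manifold.

Variable W : riemannianManifold R n.
Notation CW := (cone_manifold W).

(* dt^2 + t^2 g *)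
Definition cone_gram (i : chart_index CW) (p : CW) : 'M[R]_(n + 1) :=
  block_mx (val p.2 ^+ 2 *: gram W i p.1) 0 0 1%:M.

Lemma cone_gram_sym i p : dom CW i p -> (cone_gram i p)^T = cone_gram i p.
Proof.
move=> [ip _]; rewrite /cone_gram tr_block_mx !trmx0 trmx1 linearZ /=.
by rewrite gram_sym.
Qed.

Lemma cone_gramE (i : chart_index CW) (p : CW) (u v : 'rV[R]_(n + 1)) :
  u *m cone_gram i p *m v^T =
  val p.2 ^+ 2 *: (lsubmx u *m gram W i p.1 *m (lsubmx v)^T) +
  rsubmx u *m (rsubmx v)^T.
Proof.
rewrite -{1}[u]hsubmxK -{1}[v]hsubmxK tr_row_mx mul_row_block !mulmx0 addr0.
by rewrite add0r mulmx1 mul_row_col -scalemxAr -scalemxAl.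
Qed.

Lemma cone_gram_posdef i p : dom CW i p ->
  forall u : 'rV[R]_(n + 1), u != 0 -> 0 < (u *m cone_gram i p *m u^T) 0 0.
Proof.
move=> [ip _] u u0; rewrite cone_gramE mxE mxE.
have t0 : 0 < val p.2 ^+ 2 by rewrite exprn_gt0 // Rpos_gt0.
have rr : (rsubmx u *m (rsubmx u)^T) 0 0 = (rsubmx u 0 0) ^+ 2.
  by rewrite mxE big_ord1 [(_^T) _ _]mxE expr2.
rewrite rr; have [l0|l0] := eqVneq (lsubmx u) 0; last first.
  by rewrite ltr_pwDl ?sqr_ge0 // mulr_gt0 // gram_posdef.
rewrite l0 !mul0mx mxE mulr0 add0r lt_neqAle sqr_ge0 andbT eq_sym sqrf_eq0.
apply: contra_neq u0 => r0; rewrite -[u]hsubmxK l0 [rsubmx u]mx11_scalar r0.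
by rewrite raddf0 row_mx0.
Qed.

Lemma cone_gram_smooth i :
  smooth_on (chart CW i @` dom CW i) (cone_gram i \o param CW i).
Proof.
move=> k; rewrite cone_chart_imageT.
have oI := @chart_open _ _ W i.
have := open_cone_image oI.
set U := (X in open X) => oU.
apply: (@Ck_on_eq _ _ _ k _ (fun x : 'rV[R]_(n + 1) => block_mx
   ((rsubmx x 0 0 * rsubmx x 0 0) *:
     (gram W i \o param W i) (lsubmx x)) 0 0 1%:M)) => //.
  by move=> x [_ x0]; rewrite /= /cone_gram /= to_RposK // expr2.
have Cr : Ck_on k U (fun x : 'rV[R]_(n + 1) => rsubmx x 0 0).
  apply: (Ck_on_coord (f := rsubmx)) => //.
  exact: Ck_on_lin (@continuous_rsubmx _ _ _ _).
apply: Ck_on_mx => // a b.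
rewrite -[a]splitK -[b]splitK.
case: (fintype.split a) => a'; case: (fintype.split b) => b' /=.
- apply: (@Ck_on_eq _ _ _ k U (fun x : 'rV[R]_(n + 1) =>
    rsubmx x 0 0 * rsubmx x 0 0 *
    (gram W i \o param W i) (lsubmx x) a' b')) => //.
    by move=> x _; rewrite block_mxEul [RHS]mxE.
  apply: Ck_onM => //; first exact: Ck_onM.
  apply: (Ck_on_coord (f := (gram W i \o param W i) \o lsubmx)) => //.
  by apply: Ck_on_sub (Ck_on_linpre oI (@continuous_lsubmx _ _ _ _)
    (@gram_smooth _ _ W i k)) => x [].
- apply: Ck_on_eq (Ck_on_cst k U (0 : R)) => // x _.
  by rewrite block_mxEur mxE.
- apply: Ck_on_eq (Ck_on_cst k U (0 : R)) => // x _.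
  by rewrite block_mxEdl mxE.
- apply: Ck_on_eq (Ck_on_cst k U ((1%:M : 'M[R]_1) a' b')) => // x _.
  by rewrite block_mxEdr.
Qed.

Lemma cone_tangent_idfun (i j : chart_index CW) (p : CW) u :
  dom CW i p -> dom CW j p ->
  tangent_map (M := CW) (N := CW) idfun i j p u =
  row_mx (tangent_map (M := W) (N := W) idfun i j p.1 (lsubmx u)) (rsubmx u).
Proof.
case: p => w t [/= iw _] [/= jw _].
have oU := @open_chart_image _ _ W i _ (@dom_open _ _ W j).
set x0 := chart CW i (w, t).
have lx0 : lsubmx x0 = chart W i w by rewrite /x0 /= /cone_chart row_mxKl.
have rx0 : 0 < rsubmx x0 0 0.
  rewrite /x0 /= /cone_chart row_mxKr mxE eqxx mulr1n; exact: Rpos_gt0.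
rewrite /tangent_map -/x0.
pose tau : 'rV[R]_n -> 'rV[R]_n := local_expr (M := W) (N := W) idfun i j.
pose F (x : 'rV[R]_(n + 1)) := row_mx (tau (lsubmx x)) (rsubmx x).
have -> : 'D_u (local_expr (M := CW) (N := CW) idfun i j) x0 = 'D_u F x0.
  apply: near_eq_derive; near=> x; rewrite /local_expr /F /=.
  rewrite cone_transitionE //.
  suff [] : (chart W i @` (dom W i `&` dom W j)) (lsubmx x) /\
     0 < rsubmx x 0 0 by [].
  near: x; apply: (open_near (open_cone_image oU)) => /=; split => //.
  by rewrite lx0; exists w.
have dtau : differentiable tau (chart W i w).
  by have [+ _] := @transition_smooth _ _ W i j 1; apply; exists w.
have dtl : differentiable (tau \o lsubmx : 'rV[R]_(n + 1) -> 'rV[R]_n) x0.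
  apply: differentiable_comp; first exact: differentiable_lsubmx.
  by rewrite lx0.
have dr : differentiable (rsubmx : 'rV[R]_(n + 1) -> 'rV[R]_1) x0.
  exact: differentiable_rsubmx.
have El (k : 'I_n) : (fun x => F x 0 (lshift 1 k)) =
    (fun x => (tau \o lsubmx) x 0 k).
  by apply: funext => x; rewrite /F row_mxEl.
have Er (k : 'I_1) : (fun x => F x 0 (rshift n k)) = (fun x => rsubmx x 0 k).
  by apply: funext => x; rewrite /F row_mxEr.
have /derivable_mxP derl := diff_derivable (v := u) dtl.
have /derivable_mxP derr := diff_derivable (v := u) dr.
have derF : derivable F x0 u.
  apply/derivable_mxP => i' k; rewrite (ord1 i') -[k]splitK.
  by case: (fintype.split k) => k' /=; rewrite ?El ?Er; [exact: derl|exact: derr].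
apply/rowP => k; rewrite derive_mx // mxE -[k]splitK.
case: (fintype.split k) => k' /=.
  rewrite row_mxEl El.
  have -> : 'D_(lsubmx u) tau (chart W i w) = 'D_u (tau \o lsubmx) x0.
    rewrite !deriveE // diff_comp ?lx0 //; last exact: differentiable_lsubmx.
    by rewrite /= diff_lin // => ?; exact: continuous_lsubmx.
  by rewrite derive_mx ?mxE //; exact: diff_derivable.
rewrite row_mxEr Er.
have -> : rsubmx u = 'D_u rsubmx x0.
  by rewrite deriveE // diff_lin // => ?; exact: continuous_rsubmx.
by rewrite derive_mx ?mxE //; exact: diff_derivable.
Unshelve. all: by end_near. Qed.

Lemma cone_gram_tensor (i j : chart_index CW) (p : CW) :
  dom CW i p -> dom CW j p -> forall u v : 'rV[R]_(n + 1),
  tangent_map (M := CW) (N := CW) idfun i j p u *m cone_gram j p *m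
    (tangent_map (M := CW) (N := CW) idfun i j p v)^T =
  u *m cone_gram i p *m v^T.
Proof.
move=> ip jp u v; rewrite !cone_gramE !cone_tangent_idfun //.
by rewrite !row_mxKl !row_mxKr gram_tensor //; [case: ip|case: jp].
Qed.

Definition cone : riemannianManifold R (n + 1) := {|
  underlying := CW;
  gram := cone_gram;
  gram_sym := cone_gram_sym;
  gram_posdef := cone_gram_posdef;
  gram_smooth := cone_gram_smooth;
  gram_tensor := cone_gram_tensor
|}.

End cone.

(* Main.v *)
(* Let f be a homothety of the cone, of factor rho, and follow it along a ray
   s |-> (w, s), which has unit speed. The image has speed rho, and the height
   (w, t) |-> t is 1-Lipschitz, so the height of f (w, s) is a rho-Lipschitz
   function of s. As s -> 0 the point (w, s) leaves every compact set, hence so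
   does f (w, s); as W is compact and the height of f (w, s) stays bounded, it
   must come arbitrarily close to 0. So f multiplies heights by at most rho and,
   applying this to the inverse of f, by exactly rho. Now the radial
   component of the velocity of f (w, s) already has length rho, hence the
   component along W vanishes and f (w, s) stays on a single ray. *)
Require Import Defs.
From HB Require Import structures.
From mathcomp Require Import all_boot all_order all_algebra.
From mathcomp Require Import all_classical all_reals all_analysis.
From mathcomp Require Import ring lra.
Import Order.TTheory GRing.Theory Num.Theory.
Import numFieldNormedType.Exports.
Local Open Scope classical_set_scope.
Local Open Scope ring_scope.
Set Implicit Arguments.
Unset Strict Implicit.
Unset Printing Implicit Defensive.

(** * Locally constant functions and derivatives of curves *)

Lemma connected_locally_constant (T : topologicalType) (U : Type) (A : set T)
    (F : T -> U) : open A -> connected A ->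
  (forall x, A x -> \forall y \near x, F y = F x) ->
  forall x y, A x -> A y -> F x = F y.
Proof.
move=> oA cA locF x y Ax Ay.
(* Local constancy makes every preimage open in [A], whatever the set of values. Applied to [F x]
   and to its complement, this makes the fibre of [F x] clopen in [A]. *)
have oP (P : set U) : open (A `&` F @^-1` P).
  rewrite openE => z [Az Pz]; near=> u; split.
    by near: u; exact: open_nbhs_nbhs.
  by rewrite /preimage /= (_ : F u = F z) //; near: u; exact: locF.
have AE : A `&` F @^-1` [set F x] = A.
  apply: cA; first by exists x.
  - by exists (A `&` F @^-1` [set F x]); rewrite ?setIA ?setIid.
  exists (~` (A `&` F @^-1` (~` [set F x]))); first exact/open_closedC.
  apply/seteqP; split=> z [Az Fz]; split=> //; first by case.
  by apply: contra_notP Fz => nFz; split.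
by have [] : (A `&` F @^-1` [set F x]) y by rewrite AE.
Unshelve. all: by end_near. Qed.

Section calculus.
Variable R : realType.

Lemma derive_comp (U V W : normedModType R) (f : U -> V) (g : V -> W) x v :
  differentiable f x -> differentiable g (f x) ->
  'D_v (g \o f) x = 'D_('D_v f x) g (f x).
Proof.
move=> df dg; have dgf : differentiable (g \o f) x by exact: differentiable_comp.
by rewrite !deriveE // diff_comp.
Qed.

Lemma is_derive_row_mx (V : normedModType R) (n1 n2 : nat)
    (f : V -> 'rV[R]_n1) (g : V -> 'rV[R]_n2) x v df dg :
  is_derive x v f df -> is_derive x v g dg ->
  is_derive x v (fun y => row_mx (f y) (g y)) (row_mx df dg).
Proof.
move=> [/[dup] derf /derivable_mxP cf <-] [/[dup] derg /derivable_mxP cg <-].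
have El (k : 'I_n1) :
    (fun y => row_mx (f y) (g y) 0 (lshift n2 k)) = (fun y => f y 0 k).
  by apply: funext => y; rewrite row_mxEl.
have Er (k : 'I_n2) :
    (fun y => row_mx (f y) (g y) 0 (rshift n1 k)) = (fun y => g y 0 k).
  by apply: funext => y; rewrite row_mxEr.
have derfg : derivable (fun y => row_mx (f y) (g y)) x v.
  apply/derivable_mxP => i k; rewrite (ord1 i) -[k]splitK.
  by case: (fintype.split k) => k' /=; rewrite ?El ?Er.
apply: DeriveDef => //; apply/rowP => k; rewrite derive_mx // mxE -[k]splitK.
case: (fintype.split k) => k' /=.
  by rewrite row_mxEl El derive_mx // mxE.
by rewrite row_mxEr Er derive_mx // mxE.
Qed.

(** In a cone chart the ray over the point with coordinates [x] is this affine curve; its velocity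
    is the unit radial vector. *)
Lemma is_derive_row_mx_scalar (n : nat) (x : 'rV[R]_n) (s : R) :
  is_derive s 1 (fun r => row_mx x r%:M : 'rV[R]_(n + 1)) (row_mx 0 1%:M).
Proof.
have dx := @is_derive_cst _ R 'rV[R]_n x s 1.
have [dZ DZ] := is_diff_scalel s (1%:M : 'M[R]_1).
have dr : is_derive s 1 (fun r : R => r%:M : 'M[R]_1) 1%:M.
  have -> : (fun r : R => r%:M : 'M[R]_1) = *:%R^~ 1%:M.
    by apply: funext => r; rewrite scale_scalar_mx mulr1.
  by split; [exact: diff_derivable|rewrite deriveE // DZ scale1r].
exact: (is_derive_row_mx dx dr).
Qed.

Lemma is_derive_coord (V : normedModType R) (m n : nat) (f : V -> 'M[R]_(m, n))
    x v df i j :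
  is_derive x v f df -> is_derive x v (fun y => f y i j) (df i j).
Proof.
move=> [derf <-]; apply: DeriveDef; first by move/derivable_mxP: derf.
by rewrite derive_mx // mxE.
Qed.

(** Complements [Ck_on_linpre]: the slice at height 1 of the cone is an affine, not a linear,
    subspace of the chart coordinates. *)
Lemma Ck_on_translate (V W : normedModType R) (c : V) k (U : set V) (f : V -> W) :
  open U -> Ck_on k U f -> Ck_on k (+%R^~ c @^-1` U) (fun x => f (x + c)).
Proof.
move=> oU.
have dc x : differentiable (+%R^~ c : V -> V) x.
  by apply: differentiableD; exact: ex_diff.
have oUc : open (+%R^~ c @^-1` U).
  apply: open_preimage => // x; exact: (differentiable_continuous (dc x)).
have Dc v x : 'D_v (+%R^~ c : V -> V) x = v.
  rewrite (_ : +%R^~ c = id \+ cst c) // deriveD ?derive_id ?derive_cst ?addr0 //.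
elim: k f => [|k IH] f.
  move=> cf x /= Ux; apply: (@continuous_comp _ _ _ (+%R^~ c) f).
    exact: (differentiable_continuous (dc x)).
  exact: cf.
move=> [df Df]; split=> [x /= Ux|v].
  by apply: (@differentiable_comp _ _ _ _ (+%R^~ c) f); [exact: dc|exact: df].
apply: Ck_on_eq (IH _ (Df v)) => // x /= Ux.
by rewrite (@derive_comp _ _ _ (+%R^~ c) f) ?Dc //; exact: df.
Qed.

(** Mean value inequality, used with [k] the dilation factor for heights along a ray, and with
    [k = 0] to get constancy. *)
Lemma derive_lipschitz (a b k : R) (f : R -> R) : a < b ->
  (forall x, x \in `[a, b] -> derivable f x 1 /\ `|'D_1 f x| <= k) ->
  `|f b - f a| <= k * (b - a).
Proof.
move=> ab dfk; have [x||c] := @MVT R f ('D_1 f) a b ab.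
- move=> /subset_itv_oo_cc/dfk[df _]; exact: derivableP.
- by apply: derivable_within_continuous => x /dfk[].
- move=> /subset_itv_oo_cc/dfk[_ dc] ->.
  by rewrite normrM [X in _ * X]gtr0_norm ?subr_gt0 // ler_pM2r // subr_gt0.
Qed.

End calculus.

(** * Tangent maps in charts and inverses of homotheties *)

Section smooth_maps.
Variable R : realType.

Lemma local_exprE (m n : nat) (M : manifold R m) (N : manifold R n)
    (f : M -> N) i j p : dom M i p ->
  local_expr f i j (chart M i p) = chart N j (f p).
Proof. by move=> ip; rewrite /local_expr /= chartK. Qed.

Lemma local_expr_differentiable (m n : nat) (M : manifold R m) (N : manifold R n)
    (f : M -> N) i j p : smooth_map f -> dom M i p -> dom N j (f p) ->
  differentiable (local_expr f i j) (chart M i p).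
Proof. by move=> [_ /(_ i j 1)[+ _]] ip jfp; apply; exists p. Qed.

Lemma near_chart_image (m n : nat) (M : manifold R m) (N : manifold R n)
    (f : M -> N) i j p : continuous f -> dom M i p -> dom N j (f p) ->
  \forall x \near chart M i p, (chart M i @` (dom M i `&` f @^-1` dom N j)) x.
Proof.
move=> cf ip jfp; apply: open_near; last by exists p.
by apply: open_chart_image; apply: open_preimage => //; exact: dom_open.
Qed.

(** Chain rule. The local expressions of [g] and [f] compose to the identity only near the chart
    point, which is enough for the derivative. *)
Lemma tangent_mapK (m n : nat) (M : manifold R m) (N : manifold R n)
    (f : M -> N) (g : N -> M) i j p u :
  smooth_map f -> smooth_map g -> cancel g f ->
  dom N i p -> dom M j (g p) ->
  tangent_map f j i (g p) (tangent_map g i j p u) = u.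
Proof.
move=> sf sg gK ip jgp; rewrite /tangent_map.
have dg := local_expr_differentiable sg ip jgp.
have df : differentiable (local_expr f j i) (chart M j (g p)).
  by apply: local_expr_differentiable; rewrite ?gK.
(* The base point of the outer derivative becomes the image of [chart N i p] under the local
   expression of [g], as the chain rule requires. *)
rewrite -(local_exprE g j ip) in df *.
rewrite -derive_comp // -[RHS](derive_id (chart N i p) u).
apply: near_eq_derive; near=> x.
have [q [iq /= jgq] <-] : (chart N i @` (dom N i `&` g @^-1` dom M j)) x.
  by near: x; apply: near_chart_image => //; case: sg.
by rewrite /= local_exprE // local_exprE // gK.
Unshelve. all: by end_near. Qed.

(** The metric clause of [f] is applied at [g p] to the images of [u] and [v] under the tangent map
    of [g], which the tangent map of [f] carries back to [u] and [v]. *)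
Lemma homothety_inv (n : nat) (M : riemannianManifold R n) (rho : R)
    (f : M -> M) : homothety M rho f ->
  exists g : M -> M, [/\ homothety M rho^-1 g, cancel f g & cancel g f].
Proof.
move=> [rho0 [sf [g [fK gK sg]]] hf]; exists g; split => //; split.
- by rewrite invr_gt0.
- by split => //; exists f.
move=> i j p ip jgp u v.
have ifgp : dom M i (f (g p)) by rewrite gK.
have := hf j i (g p) jgp ifgp (tangent_map g i j p u) (tangent_map g i j p v).
rewrite !tangent_mapK // gK => ->.
by rewrite mulrA -exprMn mulVf ?gt_eqF // expr1n mul1r.
Qed.

End smooth_maps.

(** * Product maps of the cone *)

Section cone_maps.
Variables (R : realType) (n : nat).

Definition cone_map (M : manifold R n) (rho : Rpos R) (psi : M -> M)
    (p : cone_manifold M) : cone_manifold M := (psi p.1, Rpos_mul rho p.2).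

Definition Rpos_inv (rho : Rpos R) : Rpos R :=
  mkRpos (etrans (invr_gt0 (val rho)) (Rpos_gt0 rho)).

Lemma Rpos_mulVK (rho : Rpos R) : cancel (Rpos_mul rho) (Rpos_mul (Rpos_inv rho)).
Proof.
by move=> t; apply: val_inj; rewrite /= mulrA mulVf ?mul1r // gt_eqF ?Rpos_gt0.
Qed.

Lemma Rpos_mulKV (rho : Rpos R) : cancel (Rpos_mul (Rpos_inv rho)) (Rpos_mul rho).
Proof.
by move=> t; apply: val_inj; rewrite /= mulrA mulfV ?mul1r // gt_eqF ?Rpos_gt0.
Qed.

Lemma Rpos_mul_continuous (rho : Rpos R) : continuous (Rpos_mul rho).
Proof.
have -> : Rpos_mul rho = @to_Rpos R \o *%R (val rho) \o val.
  by apply: funext => t; apply: val_inj; rewrite /= to_RposK // mulr_gt0 ?Rpos_gt0.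
move=> t; apply: continuous_comp; first exact: val_Rpos_continuous.
apply: continuous_comp; first exact: mulrl_continuous.
by apply: to_Rpos_continuous; rewrite mulr_gt0 ?Rpos_gt0.
Qed.

Section cone_map_theory.
Variable M : manifold R n.
Implicit Types (psi : M -> M) (rho : Rpos R).
Notation CM := (cone_manifold M).

Lemma cone_chart_row_mx (i : chart_index CM) (w : M) (t : R) : 0 < t ->
  row_mx (chart M i w) t%:M = chart CM i (w, to_Rpos t).
Proof. by move=> t0; rewrite /= /cone_chart /= to_RposK. Qed.

Lemma local_expr_cone_map psi rho (i j : chart_index CM) (x : 'rV[R]_(n + 1)) :
  0 < rsubmx x 0 0 ->
  local_expr (cone_map rho psi) i j x =
  row_mx (local_expr psi i j (lsubmx x)) (val rho *: rsubmx x).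
Proof.
move=> x0; rewrite /local_expr /= /cone_chart /=; congr row_mx.
by rewrite to_RposK // [X in _ *: X]mx11_scalar scale_scalar_mx.
Qed.

Lemma cone_map_smooth psi rho : smooth_map psi -> smooth_map (cone_map rho psi).
Proof.
move=> [cpsi spsi]; split=> [p|i j k].
  apply: (@continuous_pair _ _ _ (psi \o fst) (Rpos_mul rho \o snd)).
    by apply: continuous_comp; [exact: cvg_fst|exact: cpsi].
  by apply: continuous_comp; [exact: cvg_snd|exact: Rpos_mul_continuous].
have -> : dom CM i `&` cone_map rho psi @^-1` dom CM j =
    (dom M i `&` psi @^-1` dom M j) `*` setT.
  by apply/seteqP; split=> [[w t] [[iw _] [jw _]]|[w t] [[iw jw] _]].
rewrite cone_chart_imageE.
have oU : open (chart M i @` (dom M i `&` psi @^-1` dom M j)).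
  by apply: open_chart_image; apply: open_preimage => //; exact: dom_open.
apply: (@Ck_on_eq _ _ _ k _ (fun x =>
    row_mx (local_expr psi i j (lsubmx x)) (val rho *: rsubmx x))).
- exact: open_cone_image.
- by move=> x [_ x0]; rewrite local_expr_cone_map.
apply: Ck_on_row_mx; first exact: open_cone_image.
  by apply: Ck_on_sub (Ck_on_linpre oU (@continuous_lsubmx _ _ _ _)
    (spsi i j k)) => x [].
apply: (Ck_on_linpost (L := *:%R (val rho)) (f := rsubmx)).
- exact: open_cone_image.
- exact: scaler_continuous.
exact: Ck_on_lin (@continuous_rsubmx _ _ _ _).
Qed.

(** For the direct implication, [psi] is recovered from the product map by restricting to the slice
    at height 1 and projecting to the base. *)
Lemma cone_map_smoothP psi rho : smooth_map (cone_map rho psi) <-> smooth_map psi.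
Proof.
split; last exact: cone_map_smooth.
move=> [cf sf].
have cpsi : continuous psi.
  have -> : psi = fst \o cone_map rho psi \o (fun w => (w, mkRpos (@ltr01 R))).
    by [].
  move=> w; apply: continuous_comp.
    by apply: continuous_pair; [exact: cvg_id|exact: cvg_cst].
  by apply: continuous_comp; [exact: cf|exact: cvg_fst].
split=> // i j k.
have one0 : 0 < (1%:M : 'M[R]_1) 0 0 by rewrite mxE ltr01.
(* In coordinates the slice at height 1 is [x |-> L x + c], where [L] appends a zero and [c] puts 1
   in the last place. *)
pose c : 'rV[R]_(n + 1) := row_mx 0 1%:M.
pose L : {linear 'rV[R]_n -> 'rV[R]_(n + 1)} := mulmxr (row_mx 1%:M 0).
have LE x : L x = row_mx x 0 by rewrite /= mul_mx_row mulmx1 mulmx0.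
have cL : continuous L.
  rewrite (funext LE : (L : _ -> _) = _) => x.
  by apply: (@continuous_row_mx _ _ _ _ id (cst 0)) => //; exact: cst_continuous.
have Lc x : L x + c = row_mx x 1%:M by rewrite LE add_row_mx addr0 add0r.
have oV := @open_chart_image _ _ CM i _ (open_preimage cf (@dom_open _ _ CM j)).
have oVc : open (+%R^~ c @^-1` (chart CM i @` (dom CM i `&`
    cone_map rho psi @^-1` dom CM j))).
  by apply: open_preimage => // x; apply: (@continuousD _ _ _ id (cst c)) => //;
    exact: cst_continuous.
have oU : open (chart M i @` (dom M i `&` psi @^-1` dom M j)).
  by apply: open_chart_image; apply: open_preimage => //; exact: dom_open.
apply: (@Ck_on_eq _ _ _ k _ (fun x =>
    lsubmx (local_expr (cone_map rho psi) i j (L x + c)))) => //.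
  by move=> x _; rewrite Lc local_expr_cone_map ?row_mxKr // row_mxKl row_mxKl.
apply: (Ck_on_linpost
    (f := fun x => local_expr (cone_map rho psi) i j (L x + c))) => //.
  exact: continuous_lsubmx.
apply: Ck_on_sub (Ck_on_linpre oVc cL (Ck_on_translate c oV (sf i j k))).
move=> _ [w [iw jw] <-].
have E : chart CM i (w, to_Rpos 1) = L (chart M i w) + c.
  by rewrite Lc -cone_chart_row_mx ?ltr01.
by exists (w, to_Rpos 1).
Qed.

Lemma diffeomorphism_cone_map psi rho :
  diffeomorphism (cone_map rho psi) <-> diffeomorphism psi.
Proof.
split=> [[/cone_map_smoothP spsi [g [fK gK sg]]]|[spsi [g [psiK gK sg]]]]; last first.
  split; first exact: cone_map_smooth.
  exists (cone_map (Rpos_inv rho) g); split; last exact: cone_map_smooth.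
    by move=> [w t]; rewrite /cone_map /= psiK Rpos_mulVK.
  by move=> [w t]; rewrite /cone_map /= gK Rpos_mulKV.
split=> //; pose one := mkRpos (@ltr01 R).
(* The given inverse [g] is not known to be a product map. The slice at height 1 yields a right
   inverse [h] of [psi]; then [cone_map (Rpos_inv rho) h] is a right inverse of the product map and
   so equals [g]. *)
pose h w := (g (w, one)).1.
have hK : cancel h psi by move=> w; have := gK (w, one) => /(congr1 fst).
have gE : g = cone_map (Rpos_inv rho) h.
  apply: funext => -[w t]; rewrite -[RHS]fK; congr g.
  by rewrite /cone_map /= hK Rpos_mulKV.
exists h; split=> //; last by move: sg; rewrite gE => /cone_map_smoothP.
by move=> w; have := fK (w, one); rewrite gE => /(congr1 fst).
Qed.

Lemma tangent_cone_map psi rho (i j : chart_index CM) (p : CM) u :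
  smooth_map psi -> dom M i p.1 -> dom M j (psi p.1) ->
  tangent_map (cone_map rho psi) i j p u =
  row_mx (tangent_map psi i j p.1 (lsubmx u)) (val rho *: rsubmx u).
Proof.
case: p => w t spsi /= iw jw; rewrite /tangent_map.
have x0E : chart CM i (w, t) = row_mx (chart M i w) (val t)%:M by [].
have t0 := Rpos_gt0 t.
set x0 := chart CM i (w, t) in x0E *.
have lx0 : lsubmx x0 = chart M i w by rewrite x0E row_mxKl.
have -> : 'D_u (local_expr (cone_map rho psi) i j) x0 =
    'D_u (fun x => row_mx (local_expr psi i j (lsubmx x)) (val rho *: rsubmx x)) x0.
  apply: near_eq_derive; near=> x; rewrite local_expr_cone_map //.
  (* The product formula is available only where the last coordinate is positive, since [to_Rpos]
     returns a default value elsewhere; this is an open condition around [x0]. *)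
  suff [] : (chart M i @` dom M i) (lsubmx x) /\ 0 < rsubmx x 0 0 by [].
  near: x; apply: (open_near (open_cone_image (@chart_open _ _ M i))) => /=.
  by rewrite lx0 x0E row_mxKr mxE; split => //; exists w.
have dpsi := local_expr_differentiable spsi iw jw.
have dl : differentiable (lsubmx : 'rV[R]_(n + 1) -> 'rV[R]_n) x0.
  exact: differentiable_lsubmx.
have dr : differentiable (rsubmx : 'rV[R]_(n + 1) -> 'rV[R]_1) x0.
  exact: differentiable_rsubmx.
have Dl : 'D_u (lsubmx : 'rV[R]_(n + 1) -> 'rV[R]_n) x0 = lsubmx u.
  by rewrite deriveE // diff_lin // => ?; exact: continuous_lsubmx.
have Dr : 'D_u (rsubmx : 'rV[R]_(n + 1) -> 'rV[R]_1) x0 = rsubmx u.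
  by rewrite deriveE // diff_lin // => ?; exact: continuous_rsubmx.
rewrite -lx0 in dpsi *.
apply: derive_val; apply: is_derive_row_mx.
  apply: DeriveDef; last by rewrite -Dl -derive_comp.
  exact: diff_derivable (differentiable_comp dl dpsi).
rewrite -Dr; apply: (@is_deriveZ _ _ _ rsubmx).
by apply: DeriveDef => //; exact: diff_derivable.
Unshelve. all: by end_near. Qed.

End cone_map_theory.

Section cone_map_metric.
Variable W : riemannianManifold R n.

Lemma innerE_cone (i : chart_index (cone W)) (p : cone W) u v :
  inner i p u v = val p.2 ^+ 2 * inner (M := W) i p.1 (lsubmx u) (lsubmx v) +
    rsubmx u 0 0 * rsubmx v 0 0.
Proof.
rewrite /inner /= cone_gramE mxE [X in X + _]mxE; congr (_ + _).
by rewrite mxE big_ord1 [(_^T) _ _]mxE.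
Qed.

(** Multiplying heights by [rho] scales both [dt^2] and the factor [t^2] in front of [g] by [rho^2],
    so what is left to ask of [psi] is that it preserve [g]. *)
Lemma cone_map_homothetyP (rho : Rpos R) (psi : W -> W) :
  homothety (cone W) (val rho) (cone_map rho psi) <-> riemannian_isometry W psi.
Proof.
split=> [[_ /diffeomorphism_cone_map dpsi hf]|[_ dpsi hpsi]]; split=> //;
    have [spsi _] := dpsi; first last.
- move=> i j p [ip _] [jp _] u v; rewrite !innerE_cone !tangent_cone_map //.
  by rewrite !row_mxKl !row_mxKr !mxE /= hpsi //; ring.
- exact/diffeomorphism_cone_map.
- exact: Rpos_gt0.
move=> i j p ip jp u v; pose t := mkRpos (@ltr01 R).
(* On vectors tangent to the slice at height 1 the cone metric is [g], and the squared height of the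
   image is [rho^2], which then cancels. *)
have := hf i j (p, t) (conj ip I) (conj jp I) (row_mx u 0) (row_mx v 0).
rewrite !innerE_cone !tangent_cone_map // !row_mxKl !row_mxKr /= scaler0 !mxE.
rewrite !mulr0 !addr0 mulr1 expr1n !mul1r => /mulfI; apply.
by rewrite expf_neq0 // gt_eqF ?Rpos_gt0.
Qed.

End cone_map_metric.
End cone_maps.

(** * Velocity of the image of a ray *)

Section rays.
Variables (R : realType) (n : nat) (W : riemannianManifold R n).
Notation CW := (cone W).
Implicit Types (f : CW -> CW) (w : W).

Lemma is_derive_ray f w (s : R) (i j : chart_index CW) :
  smooth_map f -> 0 < s -> dom W i w -> dom W j (f (w, to_Rpos s)).1 ->
  is_derive s 1 (fun r => chart CW j (f (w, to_Rpos r)))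
    (tangent_map f i j (w, to_Rpos s) (row_mx 0 1%:M)).
Proof.
move=> sf s0 iw jf.
have [dA DA] := is_derive_row_mx_scalar (chart W i w) s.
have iws : dom CW i (w, to_Rpos s) by [].
have jfs : dom CW j (f (w, to_Rpos s)) by [].
have dF := local_expr_differentiable sf iws jfs.
have E := cone_chart_row_mx i w s0; rewrite /tangent_map.
rewrite -[chart _ _ _]E in dF *.
move/derivable1_diffP: dA => dA.
apply: (@near_eq_is_derive _ _ _ (local_expr f i j \o
  (fun r => row_mx (chart W i w) r%:M : 'rV[R]_(n + 1)))).
  near=> r; have r0 : 0 < r by near: r; exact: lt_nbhsr.
  by rewrite [LHS]/comp (cone_chart_row_mx i w r0) local_exprE.
split; first by apply: diff_derivable; exact: differentiable_comp dA dF.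
by rewrite (derive_comp _ dA dF) DA.
Unshelve. all: by end_near. Qed.

(** The height is the last coordinate in every chart of the cone, so the function differentiated
    here does not depend on [i] and [j]. *)
Lemma is_derive_ray_height f w (s : R) (i j : chart_index CW) :
  smooth_map f -> 0 < s -> dom W i w -> dom W j (f (w, to_Rpos s)).1 ->
  is_derive s 1 (fun r => val (f (w, to_Rpos r)).2)
    (rsubmx (tangent_map f i j (w, to_Rpos s) (row_mx 0 1%:M)) 0 0).
Proof.
move=> sf s0 iw jf.
have := is_derive_coord 0 (rshift n 0) (is_derive_ray sf s0 iw jf).
rewrite (_ : (fun y => _) = (fun r => val (f (w, to_Rpos r)).2)) ?mxE //.
by apply: funext => r; rewrite /= /cone_chart row_mxEr mxE.
Qed.

Lemma inner_ge0 (i : chart_index W) w u : dom W i w -> 0 <= inner i w u u.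
Proof.
move=> iw; have [->|u0] := eqVneq u 0; last exact/ltW/gram_posdef.
by rewrite /inner !mul0mx mxE.
Qed.

Lemma inner_eq0 (i : chart_index W) w u : dom W i w -> inner i w u u = 0 -> u = 0.
Proof.
move=> iw /eqP; apply: contraTeq => u0.
by rewrite gt_eqF // [0 < _]gram_posdef.
Qed.

(** The ray has unit speed, so its image has speed [rho]; the left side is the squared speed split
    into the parts along [W] and along the ray direction. *)
Lemma homothety_ray_speed f (rho : R) w (s : R) (i j : chart_index CW) :
  homothety CW rho f -> dom W i w -> dom W j (f (w, to_Rpos s)).1 ->
  let T := tangent_map f i j (w, to_Rpos s) (row_mx 0 1%:M) in
  val (f (w, to_Rpos s)).2 ^+ 2 *
    inner (M := W) j (f (w, to_Rpos s)).1 (lsubmx T) (lsubmx T) +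
  rsubmx T 0 0 ^+ 2 = rho ^+ 2.
Proof.
move=> [_ _ hf] iw jf /=; rewrite [X in _ + X]expr2 -innerE_cone.
rewrite hf // innerE_cone row_mxKl row_mxKr /inner !mul0mx !mxE.
by rewrite mulr0 add0r !mulr1.
Qed.

(** In the speed identity the part along [W] is nonnegative, so the square of the radial part is at
    most [rho^2]. *)
Lemma homothety_ray_height f (rho : R) w (s : R) :
  homothety CW rho f -> 0 < s ->
  derivable (fun r => val (f (w, to_Rpos r)).2) s 1 /\
  `|'D_1 (fun r => val (f (w, to_Rpos r)).2) s| <= rho.
Proof.
move=> hf s0; have [rho0 [sf _] _] := hf.
have [i iw] := dom_cover w.
have [j jf] := dom_cover (f (w, to_Rpos s)).1.
have [? ->] := is_derive_ray_height sf s0 iw jf; split=> //.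
have := homothety_ray_speed hf iw jf; set T := tangent_map _ _ _ _ _ => /= E.
rewrite -ler_sqr ?nnegrE ?(ltW rho0) // real_normK ?num_real //.
by rewrite -E lerDr mulr_ge0 ?sqr_ge0 // inner_ge0.
Qed.

Lemma homothety_ray_lipschitz f (rho : R) w (a b : R) :
  homothety CW rho f -> 0 < a -> a < b ->
  `|val (f (w, to_Rpos b)).2 - val (f (w, to_Rpos a)).2| <= rho * (b - a).
Proof.
move=> hf a0 ab.
apply: (derive_lipschitz (f := fun r => val (f (w, to_Rpos r)).2)) => // x.
rewrite in_itv /= => /andP[ax _]; apply: homothety_ray_height => //.
exact: lt_le_trans ax.
Qed.

End rays.

(** * Homotheties of the cone over a compact manifold *)

Section cone_homotheties.
Variables (R : realType) (n : nat) (W : riemannianManifold R n).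
Hypothesis Wcompact : compact [set: W].
Notation CW := (cone W).
Implicit Types (f : CW -> CW) (rho : R).

Lemma compact_Rpos_segment (a b : R) : 0 < a ->
  compact [set t : Rpos R | a <= val t <= b].
Proof.
move=> a0; have -> : [set t : Rpos R | a <= val t <= b] = @to_Rpos R @` `[a, b].
  apply/seteqP; split=> [t tab|_ [r + <-]].
    by exists (val t); rewrite ?valRposK //= in_itv.
  by rewrite /= in_itv /= => /andP[ar rb]; rewrite to_RposK ?ar // (lt_le_trans a0).
apply: continuous_compact; last exact: segment_compact.
apply: continuous_in_subspaceT => r; rewrite inE /= in_itv /= => /andP[ar _].
by apply: to_Rpos_continuous; exact: lt_le_trans ar.
Qed.

Lemma homothety_height_le f rho p :
  homothety CW rho f -> val (f p).2 <= rho * val p.2.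
Proof.
(* If the inequality fails at (w, t), then f (w, s) stays in the compact set K for
   0 < s < t, and the height of f^-1 has a positive minimum on K, which s
   eventually undercuts. *)
move=> hf; have [rho0 _ _] := hf.
have [g [hg fK gK]] := homothety_inv hf; have [_ [[cg _] _] _] := hg.
case: p => w t /=; rewrite leNgt; apply/negP => lt_fp.
have t0 := Rpos_gt0 t.
pose phi r := val (f (w, to_Rpos r)).2.
have phit : phi (val t) = val (f (w, t)).2 by rewrite /phi valRposK.
(* The two bounds are the Lipschitz estimate over a parameter interval of length at most [val t].
   The lower one is positive precisely because the inequality is assumed to fail, which makes [K]
   compact in the cone. *)
pose K : set CW := [set: W] `*`
  [set u | phi (val t) - rho * val t <= val u <= phi (val t) + rho * val t].
have cK : compact K.
  by apply: compact_setX => //; apply: compact_Rpos_segment; rewrite subr_gt0 phit.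
have Kf : K (f (w, t)).
  by split=> //=; rewrite -phit lerDl gerDl oppr_le0 mulr_ge0 // ltW.
have ch : continuous ((val : Rpos R -> R) \o snd \o g).
  move=> q; apply: continuous_comp; first exact: cg.
  by apply: continuous_comp; [exact: cvg_snd|exact: val_Rpos_continuous].
have [|c _ minc] := compact_EVT_min _ cK (continuous_subspaceT ch).
  by exists (f (w, t)).
have m0 := Rpos_gt0 (g c).2.
pose s := Num.min (val t) (val (g c).2) / 2.
have min0 : 0 < Num.min (val t) (val (g c).2) by rewrite lt_min t0.
have s0 : 0 < s by rewrite divr_gt0.
have [st sm] : s < val t /\ s < val (g c).2.
  by apply/andP; rewrite -lt_min ltr_pdivrMr // mulr_natr mulr2n ltrDl.
have Ks : K (f (w, to_Rpos s)).
  have := homothety_ray_lipschitz w hf s0 st; rewrite -/(phi _) -/(phi s).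
  have := mulr_gt0 rho0 s0; rewrite /K /= -/(phi s) ler_norml mulrBr => h1 h2.
  by split=> //; move: h1 h2 => h1 /andP[h2 h3]; apply/andP; split; lra.
have := minc _ (mem_set Ks); rewrite /= fK /= to_RposK // leNgt sm //.
Qed.

(** The reverse inequality is the previous bound for the inverse homothety, of factor [rho^-1], at
    the point [f p]. *)
Lemma homothety_height f rho p :
  homothety CW rho f -> val (f p).2 = rho * val p.2.
Proof.
move=> hf; have [rho0 _ _] := hf; have [g [hg fK gK]] := homothety_inv hf.
apply/eqP; rewrite eq_le homothety_height_le //=.
by have := homothety_height_le (f p) hg; rewrite fK ler_pdivlMl.
Qed.

(** Heights grow at the exact rate [rho], so the radial component uses up the whole speed. The
    component along [W] then has length zero, as its coefficient, the squared height, is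
    positive. *)
Lemma homothety_ray_lsubmx f rho w (s : R) (i j : chart_index CW) :
  homothety CW rho f -> 0 < s -> dom W i w -> dom W j (f (w, to_Rpos s)).1 ->
  lsubmx (tangent_map f i j (w, to_Rpos s) (row_mx 0 1%:M)) = 0.
Proof.
move=> hf s0 iw jf; have [_ [sf _] _] := hf.
have := homothety_ray_speed hf iw jf; set T := tangent_map _ _ _ _ _ => /= ET.
have rT : rsubmx T 0 0 = rho.
  have [_ <-] := is_derive_ray_height sf s0 iw jf.
  transitivity ('D_1 (fun r : R => rho * r) s).
    apply: near_eq_derive; near=> r.
    have r0 : 0 < r by near: r; exact: lt_nbhsr.
    by rewrite (homothety_height _ hf) /= to_RposK.
  by rewrite deriveZ ?derive_id ?[_ *: _]mulr1 //; exact: derivable_id.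
apply: (inner_eq0 jf); apply/eqP.
move: ET; rewrite rT => /(canRL (addrK _)); rewrite subrr => /eqP.
by rewrite mulf_eq0 expf_eq0 /= gt_eqF ?Rpos_gt0.
Unshelve. all: by end_near. Qed.

(** Vanishing of the velocity along [W] is a statement in charts, so it gives constancy only locally
    in [s]; connectedness of the half line makes it global. *)
Lemma homothety_ray_constant f rho w (s s' : R) : homothety CW rho f ->
  0 < s -> 0 < s' -> (f (w, to_Rpos s)).1 = (f (w, to_Rpos s')).1.
Proof.
move=> hf; have [_ [[cf sf] _] _] := hf; have [i iw] := dom_cover w.
pose F r := (f (w, to_Rpos r)).1.
apply: (@connected_locally_constant _ _ [set r : R | 0 < r] F).
- exact: open_gt.
- apply/connected_intervalP => x y /= x0 y0 z /andP[xz _].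
  exact: lt_le_trans xz.
move=> {s s'} s /= s0; have [j jF] := dom_cover (F s).
have cF : {for s, continuous F}.
  rewrite /F; apply: continuous_comp; last exact: cvg_fst.
  apply: continuous_comp; last exact: cf.
  by apply: continuous_pair; [exact: cvg_cst|exact: to_Rpos_continuous].
have : \forall r \near s, 0 < r /\ dom W j (F r).
  near=> r; split; near: r; first exact: lt_nbhsr.
  by apply: cF; apply: open_nbhs_nbhs; split => //; exact: dom_open.
move=> /nbhs_ballP[e /= e0 eF].
(* A ball in the line is convex, so the whole segment from [a] to [b] stays positive and is mapped
   by [F] into the single chart domain [j]. *)
have Fab a b : a < b -> ball s e a -> ball s e b -> F a = F b.
  move=> ab sa sb.
  have eab r : r \in `[a, b] -> 0 < r /\ dom W j (F r).
    rewrite in_itv /= => /andP[ar rb]; apply: eF; move: sa sb.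
    by rewrite /ball /= !ltr_distlC => /andP[? ?] /andP[? ?]; apply/andP; split; lra.
  have [a0 ja] : 0 < a /\ dom W j (F a) by apply: eab; rewrite in_itv /= lexx ltW.
  have [b0 jb] : 0 < b /\ dom W j (F b) by apply: eab; rewrite in_itv /= lexx ltW.
  rewrite -(chartK ja) -(chartK jb); congr (param W j _); apply/rowP => k.
  pose c r := chart CW j (f (w, to_Rpos r)) 0 (lshift 1 k).
  have cE r : c r = chart W j (F r) 0 k by rewrite /c /= /cone_chart row_mxEl.
  (* The zero bound is written as [0 * (b - a)]: each base coordinate has zero derivative, and the
     mean value inequality applies with constant 0. *)
  rewrite -!cE; apply/esym/eqP; rewrite -subr_eq0 -normr_le0 -(mul0r (b - a)).
  apply: derive_lipschitz => // r /eab[r0 jr].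
  have [? ->] := is_derive_coord 0 (lshift 1 k) (is_derive_ray (conj cf sf) r0 iw jr).
  split=> //; have := homothety_ray_lsubmx hf r0 iw jr.
  by move=> /rowP/(_ k); rewrite !mxE => ->; rewrite normr0.
apply/nbhs_ballP; exists e => //= r sr.
have ss := ballxx s e0.
by have [rs|rs|->] := ltgtP r s; [exact: Fab|exact/esym/Fab|].
Unshelve. all: by end_near. Qed.

Lemma homothety_cone_map f (rho : Rpos R) :
  homothety CW (val rho) f -> exists psi, f = cone_map rho psi.
Proof.
(* Since the base component is constant along each ray, it may be read off at height 1. *)
move=> hf; exists (fun w => (f (w, to_Rpos 1)).1); apply: funext => -[w t].
rewrite [LHS]surjective_pairing; congr (_, _); last first.
  by apply: val_inj; rewrite (homothety_height _ hf).
by rewrite -[t]valRposK; exact: homothety_ray_constant hf (Rpos_gt0 t) ltr01.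
Qed.

Lemma cone_homothetyP f (rho : Rpos R) :
  homothety CW (val rho) f <->
  exists psi : W -> W, riemannian_isometry W psi /\
    forall (w : W) (t : Rpos R), f (w, t) = (psi w, Rpos_mul rho t).
Proof.
split=> [hf|[psi [ipsi fE]]].
  have [psi fE] := homothety_cone_map hf; exists psi; split; last by rewrite fE.
  by apply/(cone_map_homothetyP rho); rewrite -fE.
by rewrite (_ : f = cone_map rho psi) ?cone_map_homothetyP //; apply: funext => -[].
Qed.

End cone_homotheties.

Unset Implicit Arguments.

Theorem theorem5p1 (R : realType) (n : nat) (W : riemannianManifold R n)
    (Wcompact : compact [set: W]) :
  (forall (rho : Rpos R) (f : cone W -> cone W),
     homothety (cone W) (val rho) f <->
     exists psi : W -> W, riemannian_isometry W psi /\
       forall (w : W) (t : Rpos R), f (w, t) = (psi w, Rpos_mul rho t)) /\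
  (forall f : cone W -> cone W,
     riemannian_isometry (cone W) f <->
     exists psi : W -> W, riemannian_isometry W psi /\
       forall (w : W) (t : Rpos R), f (w, t) = (psi w, t)).
Proof.
have homP := cone_homothetyP Wcompact; split=> [rho f|f]; first exact: homP.
(* [val one] reduces to 1, so an isometry of the cone is a homothety of factor [val one] and the
   first clause applies to it. *)
pose one := mkRpos (@ltr01 R).
have mul1 (t : Rpos R) : Rpos_mul one t = t by apply: val_inj; rewrite /= mul1r.
split=> [/(homP f one)[psi [ipsi fE]]|[psi [ipsi fE]]].
  by exists psi; split=> // w t; rewrite fE mul1.
by apply/(homP f one); exists psi; split=> // w t; rewrite fE mul1.
Qed.
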